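(* Let $n\ge2$ be even, and let $$\tilde p_n(T,U)=T^{n+1}+\zeta_1T^nU+\zeta_2T^{n-1}U^2+\cdots+\zeta_nTU^n+U^{n+1},$$ with $\zeta_j\in\mathbb{C}$ and $\zeta_j=\overline{\zeta_{n+1-j}}$ for $j=1,\dots,n$. Let $$\tilde q_n(X,Y)=\tilde p_n(X+iY,\,X-iY)=\sum_{j=0}^{n+1}d_jX^{n+1-j}Y^j,\qquad d_j\in\mathbb{R},$$ and assume $d_0\ne0$. Then $$\mathrm{Dis}(\tilde q_n(X,1))=2^{n(n+1)}\det H_n .$$
   Context: Since $\tilde p_n$ satisfies $\zeta_j=\overline{\zeta_{n+1-j}}$ (with $\zeta_0=\zeta_{n+1}=1$), the form $\tilde q_n$ has real coefficients. Discriminant: with $x'_1,\dots,x'_{n+1}$ the complex roots (with multiplicity) of $\tilde q_n(X,1)$, $$\mathrm{Dis}(\tilde q_n(X,1))=d_0^{2n}\prod_{1\le j<k\le n+1}(x'_j-x'_k)^2 .$$ Matrix $H_n$: for the same numbers $\zeta_1,\dots,\zeta_n$, let $t_1,\dots,t_{n+1}\in\mathbb{C}$ be the roots (with multiplicity) of $T^{n+1}-\zeta_1T^n+\zeta_2T^{n-1}-\cdots+(-1)^n\zeta_nT+(-1)^{n+1}$, so that $\zeta_j$ is the $j$-th elementary symmetric function of $t_1,\dots,t_{n+1}$ and $t_1\cdots t_{n+1}=1$. For $m\in\mathbb{Z}$ put $h_m=h_m(\zeta_1,\dots,\zeta_n)=\sum_{j=1}^{n+1}t_j^m$ (a polynomial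 in $\zeta_1,\dots,\zeta_n$, also for $m<0$). Then $H_n$ is the $(n+1)\times(n+1)$ matrix whose entry in row $a$ and column $b$ ($0\le a,b\le n$) is $h_{a-b}$. *)

(* Defs.v *)
From HB Require Import structures.
From mathcomp Require Import all_boot all_order all_algebra.
From mathcomp Require Import reals complex mpoly.

Set Implicit Arguments.
Unset Strict Implicit.
Unset Printing Implicit Defensive.

Import Order.TTheory GRing.Theory Num.Theory.
Local Open Scope ring_scope.

(* The complex roots of p, each listed with its multiplicity; the order of    *)
(* the list is unspecified, and the list is empty when p = 0.                 *)
Definition croots (F : closedFieldType) (p : {poly F}) : seq F :=
  sval (closed_field_poly_normal p).

(* a ^+ (2 * deg p - 2) times the product of the squared root differences,    *)
(* where a is the leading coefficient of p; (size p).-2 is deg p - 1.         *)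
Definition discriminant (F : closedFieldType) (p : {poly F}) : F :=
  lead_coef p ^+ (2 * (size p).-2) *
  \prod_(k < size (croots p)) \prod_(j < k)
    ((croots p)`_j - (croots p)`_k) ^+ 2.

(* In binary forms, 'X_ord0 and 'X_ord_max are the first and second           *)
(* variables. Only the values zeta 1, ..., zeta n are ever used.              *)
Definition ptilde (F : closedFieldType) (n : nat) (zeta : nat -> F) :
    {mpoly F[2]} :=
  'X_ord0 ^+ n.+1
  + \sum_(1 <= j < n.+1) zeta j *: ('X_ord0 ^+ (n.+1 - j) * 'X_ord_max ^+ j)
  + 'X_ord_max ^+ n.+1.

Definition qtilde (F : numClosedFieldType) (n : nat) (zeta : nat -> F) :
    {mpoly F[2]} :=
  ptilde n zeta \mPo [tuple 'X_ord0 + 'i *: 'X_ord_max;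
                            'X_ord0 - 'i *: 'X_ord_max].

(* The univariate polynomial q(X, 1). *)
Definition dehomog (F : closedFieldType) (q : {mpoly F[2]}) : {poly F} :=
  mmap polyC (tnth [tuple 'X; 1]) q.

(* The polynomial whose roots have elementary symmetric functions             *)
(* zeta 1, ..., zeta n, 1.                                                    *)
Definition tpoly (F : closedFieldType) (n : nat) (zeta : nat -> F) : {poly F} :=
  'X ^+ n.+1 + \sum_(1 <= j < n.+1) ((-1) ^+ j * zeta j) *: 'X ^+ (n.+1 - j)
  + (-1) ^+ n.+1.

Definition hsum (F : closedFieldType) (n : nat) (zeta : nat -> F) (m : int) : F :=
  \sum_(t <- croots (tpoly n zeta)) t ^ m.

Definition Hmx (F : closedFieldType) (n : nat) (zeta : nat -> F) : 'M[F]_n.+1 :=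
  \matrix_(a < n.+1, b < n.+1) hsum n zeta (a%:Z - b%:Z).

(* Main.v *)
(* Let t range over the roots of tpoly.  Then ptilde = \prod_t (T + t U), hence
   qtilde = \prod_t ((1 + t) X + i (1 - t) Y): the roots of qtilde(X, 1) are the
   images of the t's under the Cayley map phi(t) = - i (1 - t) / (1 + t), and
     phi(t) - phi(t') = 2 i (t - t') / ((1 + t) (1 + t')).
   On the other side Hmx is a Vandermonde matrix in the t's times the transpose of
   the one in the t^-1's, and \prod_t t = 1; both sides are then products over pairs.
   The coefficients of qtilde are real because conjugation exchanges X + iY and
   X - iY as well as zeta_j and zeta_(n+1-j). *)
Require Import Defs.
From mathcomp Require Import all_boot all_order all_algebra.
From mathcomp Require Import reals complex mpoly ring zify.
Import Order.TTheory GRing.Theory Num.Theory.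

Set Implicit Arguments.
Unset Strict Implicit.
Unset Printing Implicit Defensive.

Local Open Scope ring_scope.

(** * Homogenization of products of linear factors *)

(* The degree k homogenization of p, evaluated at (x, y); the constant
   coefficient of p goes with x ^+ k. *)
Definition homog_eval (F : nzRingType) (A : comAlgType F) (k : nat) (p : {poly F}) (x y : A) : A :=
  \sum_(j < k.+1) p`_j *: (x ^+ (k - j) * y ^+ j).

(** The form [ptilde] with arguments in any commutative [F]-algebra, so that [ptilde], [qtilde] and
    the univariate polynomials obtained from [qtilde] are all instances. *)
Definition binform (F : nzRingType) (A : comAlgType F) (n : nat) (zeta : nat -> F) (x y : A) : A :=
  x ^+ n.+1 + \sum_(1 <= j < n.+1) zeta j *: (x ^+ (n.+1 - j) * y ^+ j) + y ^+ n.+1.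

Lemma homog_eval_linear_factor (F : comNzRingType) (A : comAlgType F) (k : nat) (p : {poly F})
    (u v : F) (x y : A) :
  (size p <= k.+1)%N ->
  homog_eval k.+1 ((u%:P + v *: 'X) * p) x y = (u *: x + v *: y) * homog_eval k p x y.
Proof.
move=> szp; rewrite /homog_eval.
under eq_bigr => j _ do
  rewrite mulrDl coefD coefCM -scalerAl coefZ coefXM scalerDl.
rewrite big_split /= mulrDl !mulr_sumr; congr (_ + _).
  (* The constant [u] leaves a term with the coefficient of [p] at [k.+1], which vanishes by the
     size bound; below, the factor ['X] shifts indices by one. *)
  rewrite big_ord_recr /= (nth_default 0 szp) mulr0 scale0r addr0.
  apply: eq_bigr => j _; rewrite subSn -1?ltnS // exprS.
  by rewrite -scalerAr -!scalerAl scalerA mulrA [p`_j * u]mulrC.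
rewrite big_ord_recl /= mulr0 scale0r add0r.
apply: eq_bigr => j _; rewrite /bump /= add1n subSS exprS.
by rewrite -scalerAr -!scalerAl scalerA [p`_j * v]mulrC (mulrCA y).
Qed.

Lemma size_prod_linear_factors (F : comNzRingType) (I : Type) (s : seq I) (u v : I -> F) :
  (size (\prod_(t <- s) ((u t)%:P + v t *: 'X))%R <= (size s).+1)%N.
Proof.
elim: s => [|t s IH]; first by rewrite big_nil size_polyC leq_b1.
rewrite big_cons mulrDl -scalerAl mul_polyC.
apply: (leq_trans (size_polyD _ _)); rewrite geq_max.
rewrite (leq_trans (size_scale_leq _ _)) ?(leq_trans IH) //=.
apply: (leq_trans (size_scale_leq _ _)); rewrite mulrC.
by apply: (leq_trans (size_polyMleq _ _)); rewrite size_polyX addn2.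
Qed.

Lemma homog_eval_prod (F : comNzRingType) (A : comAlgType F) (I : Type) (s : seq I) (u v : I -> F)
    (x y : A) :
  homog_eval (size s) (\prod_(t <- s) ((u t)%:P + v t *: 'X)) x y =
  \prod_(t <- s) (u t *: x + v t *: y).
Proof.
elim: s => [|t s IH].
  by rewrite !big_nil /homog_eval big_ord1 coef1 scale1r expr0 mulr1.
by rewrite !big_cons /= homog_eval_linear_factor ?IH // size_prod_linear_factors.
Qed.

(** * Coefficients and roots of [tpoly] *)

Lemma coef_tpoly (F : closedFieldType) (n : nat) (zeta : nat -> F) (k : nat) :
  (tpoly n zeta)`_k =
  (k == n.+1)%:R + (if (0 < k <= n)%N then (-1) ^+ (n.+1 - k) * zeta (n.+1 - k)%N else 0)
  + (if k == 0 then (-1) ^+ n.+1 else 0).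
Proof.
rewrite /tpoly !coefD coefXn coef_sum; congr (_ + _ + _); last first.
  by rewrite -polyCN -rmorphXn coefC.
under eq_bigr => j _ do rewrite coefZ coefXn.
case: ifP => [/andP[k0 kn]|kn]; last first.
  rewrite big_nat big1 // => j /andP[j1 jn].
  case: eqP => [ek|]; last by rewrite mulr0.
  lia.
rewrite (bigD1_seq (n.+1 - k)%N) ?iota_uniq ?mem_index_iota //=; last lia.
rewrite subKn ?(leqW kn) // eqxx mulr1 big_seq_cond big1 ?addr0 // => j.
rewrite mem_index_iota => /andP[/andP[j1 jn]] /eqP njk.
case: eqP => [ek|]; last by rewrite mulr0.
lia.
Qed.

Lemma size_tpoly (F : closedFieldType) (n : nat) (zeta : nat -> F) :
  size (tpoly n zeta) = n.+2.
Proof.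
apply/eqP; rewrite eqn_leq; apply/andP; split.
  apply/leq_sizeP => j nj; rewrite coef_tpoly !gtn_eqF //; last exact: leq_trans nj.
  by rewrite [(j <= n)%N]leqNgt (ltnW nj) andbF !addr0.
rewrite ltnNge; apply/negP => /leq_sizeP/(_ n.+1 (leqnn _)).
by rewrite coef_tpoly eqxx ltnn andbF !addr0 => /eqP; rewrite oner_eq0.
Qed.

Lemma tpoly_monic (F : closedFieldType) (n : nat) (zeta : nat -> F) :
  tpoly n zeta \is monic.
Proof.
rewrite monicE lead_coefE size_tpoly /= coef_tpoly eqxx ltnn andbF !addr0 //.
Qed.

Lemma croots_eq (F : closedFieldType) (p : {poly F}) :
  p = lead_coef p *: \prod_(z <- croots p) ('X - z%:P).
Proof. by rewrite /croots; case: closed_field_poly_normal. Qed.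

Lemma tpoly_croots (F : closedFieldType) (n : nat) (zeta : nat -> F) :
  tpoly n zeta = \prod_(t <- croots (tpoly n zeta)) ('X - t%:P).
Proof.
by rewrite {1}[LHS]croots_eq (monicP (tpoly_monic _ _)) scale1r.
Qed.

Lemma size_croots_tpoly (F : closedFieldType) (n : nat) (zeta : nat -> F) :
  size (croots (tpoly n zeta)) = n.+1.
Proof.
by apply: succn_inj; rewrite -(size_tpoly n zeta) {2}tpoly_croots size_prod_XsubC.
Qed.

(** Compare constant coefficients: both carry the sign [(-1) ^+ n.+1]. *)
Lemma prod_croots_tpoly (F : closedFieldType) (n : nat) (zeta : nat -> F) :
  \prod_(t <- croots (tpoly n zeta)) t = 1.
Proof.
have sgn0 : (-1) ^+ n.+1 != 0 :> F by rewrite signr_eq0.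
apply: (mulfI sgn0); have := coef0_prod_XsubC (croots (tpoly n zeta)).
rewrite -tpoly_croots size_croots_tpoly coef_tpoly /= !add0r.
by rewrite mulr1.
Qed.

Lemma croots_tpoly_neq0 (F : closedFieldType) (n : nat) (zeta : nat -> F) (t : F) :
  t \in croots (tpoly n zeta) -> t != 0.
Proof.
have : \prod_(t <- croots (tpoly n zeta)) t != 0 by rewrite prod_croots_tpoly oner_eq0.
by rewrite prodf_seq_neq0 => /allP h /h.
Qed.

(** * Factorization and symmetries of the binary form *)

(** The right side is [tpoly] homogenized at [(- y, x)]; the minus sign absorbs the alternating
    signs of [tpoly]. *)
Lemma binform_prod (F : closedFieldType) (A : comAlgType F) (n : nat) (zeta : nat -> F) (x y : A) :
  binform n zeta x y = \prod_(t <- croots (tpoly n zeta)) (x + t *: y).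
Proof.
have sign k : (-1) ^+ k *: (- y) ^+ k = y ^+ k.
  by rewrite -[- y]scaleN1r exprZn scalerA -exprMn mulrNN mulr1 expr1n scale1r.
have -> : \prod_(t <- croots (tpoly n zeta)) (x + t *: y) =
   homog_eval n.+1 (tpoly n zeta) (- y) x.
  rewrite [in RHS]tpoly_croots -{1}(size_croots_tpoly n zeta).
  under [in RHS]eq_bigr => t _ do rewrite addrC -polyCN -['X]scale1r.
  rewrite homog_eval_prod; apply: eq_bigr => t _; by rewrite scalerN scaleNr opprK scale1r addrC.
rewrite /homog_eval big_ord_recl big_ord_recr /= /bump /= !coef_tpoly /= add1n.
rewrite eqxx ltnn !addr0 !add0r !expr0 mulr1 scale1r subnn mul1r.
(* [homog_eval] is indexed here by the power of [x], [binform] by that of [y], hence the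
   reversal. *)
rewrite subn0 sign /binform big_nat_rev /= big_add1 big_mkord.
rewrite [RHS]addrC [X in X + _ = _]addrC; congr (_ + _ + _); apply: eq_bigr => i _.
have ltin := ltn_ord i.
rewrite coef_tpoly !add1n !subSS !eqSS ltn_eqF //= addr0 ltin add0r.
rewrite [_ * zeta _]mulrC -scalerA [(-1) ^+ _ *: _]scalerAl sign [in RHS]mulrC.
by congr (_ *: (_ ^+ _ * _)); move: ltin => /=; lia.
Qed.

Lemma rmorph_binform (F : nzRingType) (A B : comAlgType F) (f : {rmorphism A -> B})
    (n : nat) (zeta : nat -> F) (x y : A) :
  scalable f -> f (binform n zeta x y) = binform n zeta (f x) (f y).
Proof.
move=> fZ; rewrite /binform !rmorphD !rmorphXn rmorph_sum; congr (_ + _ + _).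
by apply: eq_bigr => j _ /=; rewrite fZ rmorphM !rmorphXn.
Qed.

Lemma binform_sym (F : nzRingType) (A : comAlgType F) (n : nat) (zeta : nat -> F) (x y : A) :
  binform n (fun j => zeta (n.+1 - j)%N) x y = binform n zeta y x.
Proof.
rewrite /binform [LHS]addrC [X in _ + X = _]addrC addrA; congr (_ + _ + _).
rewrite big_nat_rev; apply: eq_big_nat => j /andP[_ jn].
by rewrite add1n subSS subKn 1?ltnW // mulrC.
Qed.

(** Meant for complex conjugation, which is not [F]-linear and therefore also acts on [zeta]. *)
Lemma map_poly_binform (F : comNzRingType) (f : {rmorphism F -> F}) (n : nat)
    (zeta : nat -> F) (x y : {poly F}) :
  map_poly f (binform n zeta x y) =
  binform n (f \o zeta) (map_poly f x) (map_poly f y).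
Proof.
rewrite /binform !rmorphD !rmorphXn rmorph_sum; congr (_ + _ + _).
by apply: eq_bigr => j _ /=; rewrite map_polyZ rmorphM !rmorphXn.
Qed.

(** * The form [qtilde] in one variable *)

Lemma qtilde_binform (F : numClosedFieldType) (n : nat) (zeta : nat -> F) :
  qtilde n zeta = binform n zeta ('X_ord0 + 'i *: 'X_ord_max) ('X_ord0 - 'i *: 'X_ord_max).
Proof.
rewrite /qtilde -[ptilde n zeta]/(binform n zeta 'X_ord0 'X_ord_max).
rewrite (rmorph_binform (f := comp_mpoly _)) /=; last by move=> c p; rewrite comp_mpolyZ.
by rewrite !comp_mpolyXU.
Qed.

(** Both sides split over the roots t into the factors (1 + t) X + i (1 - t) Y. The coefficients of
    [qtilde] can thus be read off the univariate q(1, X). *)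
Lemma qtilde_homog_eval (F : numClosedFieldType) (n : nat) (zeta : nat -> F) :
  qtilde n zeta =
  homog_eval n.+1 (binform n zeta (1 + 'i *: 'X) (1 - 'i *: 'X)) 'X_ord0 'X_ord_max.
Proof.
rewrite qtilde_binform !binform_prod -{1}(size_croots_tpoly n zeta).
rewrite (eq_bigr (fun t => (1 + t) *: 'X_ord0 + ('i * (1 - t)) *: 'X_ord_max)); last first.
  move=> t _; rewrite scalerDr scalerN scalerA addrACA -scalerBl scalerDl scale1r.
  by congr (_ + _ *: _); ring.
rewrite -homog_eval_prod; congr (homog_eval _ _ _ _); apply: eq_bigr => t _.
rewrite scalerDr scalerN scalerA addrACA -scalerBl alg_polyC polyCD.
by congr (_ + _ *: _); ring.
Qed.

Lemma dehomog_qtilde (F : numClosedFieldType) (n : nat) (zeta : nat -> F) :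
  dehomog (qtilde n zeta) =
  \prod_(t <- croots (tpoly n zeta)) (('i * (1 - t))%:P + (1 + t) *: 'X).
Proof.
rewrite qtilde_binform /dehomog (rmorph_binform (f := mmap _ _)) /=; last first.
  by move=> c p; rewrite mmapZ mul_polyC.
rewrite binform_prod; apply: eq_bigr => t _.
rewrite mmapD mmapB !mmapZ !mmapX !mmap1U !(tnth_nth 0) /= mulr1.
rewrite -!mul_polyC !polyCM !polyCD polyCN; ring.
Qed.

(** Some [v t] may vanish, so this is the coefficient at the formal degree and not always the
    leading one. *)
Lemma coef_prod_linear_factors (F : comNzRingType) (I : Type) (s : seq I) (u v : I -> F) :
  (\prod_(t <- s) ((u t)%:P + v t *: 'X))`_(size s) = \prod_(t <- s) v t.
Proof.
elim: s => [|t s IH]; first by rewrite !big_nil coef1.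
rewrite !big_cons mulrDl coefD coefCM nth_default ?mulr0 ?add0r.
  by rewrite -scalerAl coefZ coefXM /= IH.
exact: size_prod_linear_factors.
Qed.

(** * Products over pairs and the determinant of [Hmx] *)

(** Each index occurs in [N.-1] pairs. *)
Lemma prod_pairs_mul (F : comNzRingType) (N : nat) (w : nat -> F) :
  \prod_(k < N) \prod_(j < k) (w j * w k) = (\prod_(k < N) w k) ^+ N.-1.
Proof.
case: N => [|N]; first by rewrite !big_ord0.
elim: N => [|N IH]; first by rewrite big_ord1 big_ord0.
rewrite big_ord_recr IH big_split /= prodr_const card_ord.
by rewrite [in RHS]big_ord_recr /= exprMn mulrA -exprSr.
Qed.

Lemma prod_pairs_exchange (F : comNzRingType) (N : nat) (f : nat -> nat -> F) :
  \prod_(i < N) \prod_(j < N | (i < j)%N) f i j = \prod_(j < N) \prod_(i < j) f i j.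
Proof.
rewrite (exchange_big_dep predT) //=; apply: eq_bigr => j _.
by rewrite -(big_ord_widen_cond N predT (fun i => f i j)) // ltnW.
Qed.

(** Any reordering [s] of the roots is allowed, so that it can later follow the order in which the
    roots of q(X, 1) are listed. *)
Lemma det_Hmx (F : closedFieldType) (n : nat) (zeta : nat -> F) (s : seq F) :
  perm_eq (croots (tpoly n zeta)) s ->
  \det (Hmx n zeta) =
  \prod_(k < n.+1) \prod_(j < k) ((s`_k - s`_j) * ((s`_k)^-1 - (s`_j)^-1)).
Proof.
move=> ps; have szs : size s = n.+1 by rewrite -(perm_size ps) size_croots_tpoly.
have s0 (j : 'I_n.+1) : s`_j != 0.
  by apply: (@croots_tpoly_neq0 _ n zeta); rewrite (perm_mem ps) mem_nth ?szs.
pose V (f : nat -> F) := Vandermonde n.+1 (\row_(j < n.+1) f j).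
(* h_(a-b) is the sum of s_j^a (s_j^-1)^b; splitting the exponent needs s_j nonzero. *)
have -> : Hmx n zeta = V (nth 0 s) *m (V (fun j => (s`_j)^-1))^T.
  apply/matrixP => a b; rewrite !mxE /hsum (perm_big _ ps) (big_nth 0) big_mkord szs.
  apply: eq_bigr => j _; rewrite !mxE expfzDr ?s0 //.
  by rewrite exprVn -exprnN.
rewrite det_mulmx det_tr !det_Vandermonde -big_split /=.
under eq_bigr => i _ do rewrite -big_split /=.
rewrite -(prod_pairs_exchange _ (fun i j => (s`_j - s`_i) * ((s`_j)^-1 - (s`_i)^-1))).
by apply: eq_bigr => i _; apply: eq_bigr => j _; rewrite !mxE.
Qed.

(** * The discriminant of q(X, 1) *)

Lemma discriminant_dehomog_qtilde (F : numClosedFieldType) (n : nat) (zeta : nat -> F) :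
  (dehomog (qtilde n zeta))`_n.+1 != 0 ->
  discriminant (dehomog (qtilde n zeta)) = 2 ^+ (n * n.+1) * \det (Hmx n zeta).
Proof.
set q := dehomog _; set ts := croots (tpoly n zeta) => q0.
have szt : size ts = n.+1 by exact: size_croots_tpoly.
have qE : q = \prod_(t <- ts) (('i * (1 - t))%:P + (1 + t) *: 'X) by exact: dehomog_qtilde.
(* [W] is the coefficient of X^(n+1), nonzero by hypothesis; so no t equals -1, and q(X, 1) has
   degree exactly n + 1. *)
pose W := \prod_(t <- ts) (1 + t).
have W0 : W != 0 by rewrite /W -(coef_prod_linear_factors _ (fun t => 'i * (1 - t))) -qE szt.
have t1 t : t \in ts -> 1 + t != 0.
  by move: W0; rewrite prodf_seq_neq0 => /allP h /h.
pose phi (t : F) : F := - ('i * (1 - t)) / (1 + t).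
have qE2 : q = W *: \prod_(z <- map phi ts) ('X - z%:P).
  rewrite qE big_map /W -mul_polyC rmorph_prod -big_split /=.
  rewrite !big_seq; apply: eq_bigr => t /t1 ht.
  have -> : 'i * (1 - t) = - ((1 + t) * phi t) by rewrite /phi; field.
  by rewrite polyCN polyCM -mul_polyC mulrBr addrC.
have lq : lead_coef q = W by rewrite qE2 lead_coefZ lead_coef_prod_XsubC mulr1.
have sq : size q = n.+2 by rewrite qE2 size_scale // size_prod_XsubC size_map szt.
set xs := croots q.
have pxs : perm_eq (map phi ts) xs.
  apply: prod_XsubC_eq; apply: (scalerI W0).
  by rewrite -qE2 {1}[q]croots_eq lq.
have szx : size xs = n.+1 by rewrite -(perm_size pxs) size_map.
(* The inverse of [phi]. Its denominator is nonzero on the values of [phi], since phi(t) - i = -2i /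
   (1 + t). *)
pose psi (z : F) : F := - (z + 'i) / (z - 'i).
have i0 : 'i != 0 :> F by exact: neq0Ci.
have two0 : 2 != 0 :> F by rewrite pnatr_eq0.
have phiK t : t \in ts -> psi (phi t) = t.
  move=> /t1 ht; rewrite /psi.
  have -> : phi t + 'i = 2 * 'i * t / (1 + t) by rewrite /phi; field.
  have -> : phi t - 'i = - (2 * 'i) / (1 + t) by rewrite /phi; field.
  by field; rewrite ht i0.
(* The roots t, listed so that [phi] sends the k-th one to the k-th entry of [xs]. *)
pose s := map psi xs.
have ps : perm_eq ts s.
  have {1}-> : ts = map psi (map phi ts).
    by rewrite -map_comp -[LHS]map_id; apply/eq_in_map => t /phiK.
  exact: perm_map.
have szs : size s = n.+1 by rewrite size_map.
have sP k : (k < n.+1)%N -> 1 + s`_k != 0 /\ xs`_k = phi s`_k.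
  move=> kn; rewrite (nth_map 0) ?szx //.
  have : xs`_k \in map phi ts by rewrite (perm_mem pxs) mem_nth ?szx.
  by case/mapP => t tin ->; rewrite phiK // t1.
have prods (f : F -> F) : \prod_(t <- ts) f t = \prod_(k < n.+1) f s`_k.
  by rewrite (perm_big _ ps) (big_nth 0) big_mkord szs.
have s0 k : (k < n.+1)%N -> s`_k != 0.
  move=> kn; apply: (@croots_tpoly_neq0 _ n zeta).
  by rewrite -/ts (perm_mem ps) mem_nth ?szs.
rewrite /discriminant -/xs szx lq sq /= (det_Hmx ps).
(* Chosen so that the squared difference of the roots j and k is g_j g_k times the corresponding
   factor of [det_Hmx]. *)
pose g k : F := 2 * s`_k / (1 + s`_k) ^+ 2.
have -> : \prod_(k < n.+1) \prod_(j < k) (xs`_j - xs`_k) ^+ 2 =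
  (\prod_(k < n.+1) g k) ^+ n *
  \prod_(k < n.+1) \prod_(j < k) ((s`_k - s`_j) * ((s`_k)^-1 - (s`_j)^-1)).
  rewrite -[X in _ ^+ X]/(n.+1.-1) -prod_pairs_mul -big_split /=; apply: eq_bigr => k _.
  rewrite -big_split /=; apply: eq_bigr => j _.
  have kn := ltn_ord k; have jn := ltn_trans (ltn_ord j) kn.
  have [wk ->] := sP k kn; have [wj ->] := sP j jn.
  have sk := s0 k kn; have sj := s0 j jn.
  have -> : phi s`_j - phi s`_k = 2 * 'i * (s`_j - s`_k) / ((1 + s`_j) * (1 + s`_k)).
    by rewrite /phi; field; rewrite wk wj.
  (* The sign from i^2 = -1 matches the one in (a - b) (a^-1 - b^-1) = - (a - b)^2 / (a b). *)
  rewrite !exprMn sqrCi /g; field; by rewrite sk sj wk wj.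
rewrite mulrA; congr (_ * _).
(* As the t's have product 1, only 2^(n+1) / W^2 remains; its n-th power cancels the factor W^(2n)
   of the discriminant. *)
have -> : \prod_(k < n.+1) g k = 2 ^+ n.+1 / W ^+ 2.
  rewrite /g !big_split /= prodr_const card_ord -(prods id) prod_croots_tpoly mulr1.
  by rewrite prodfV prodrXl -(prods (fun t => 1 + t)).
by rewrite expr_div_n -!exprM mulrC divfK ?expf_neq0 // mulnC.
Qed.

(** * Real coefficients and conclusion *)

(** Only the term j = 0 reaches degree [m] in X. This turns the assumption on d_0 into one on the
    coefficient of X^(n+1). *)
Lemma dehomog_binary_form (F : closedFieldType) (m : nat) (c : 'I_m.+1 -> F) :
  (dehomog (\sum_(j < m.+1) c j *: ('X_ord0 ^+ (m - j) * 'X_ord_max ^+ j)))`_m = c ord0.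
Proof.
rewrite /dehomog rmorph_sum coef_sum big_ord_recl big1 /= => [|j _];
  rewrite mmapZ rmorphM !rmorphXn /= !mmapX !mmap1U !(tnth_nth 0) /=;
  rewrite expr1n mulr1 coefCM coefXn.
  by rewrite subn0 eqxx mulr1 addr0.
by rewrite /bump /= gtn_eqF ?mulr0 //; case: j => /= *; lia.
Qed.

Lemma conj_binform_Cayley (F : numClosedFieldType) (n : nat) (zeta : nat -> F) :
  (forall j : nat, (1 <= j <= n)%N -> zeta j = (zeta (n.+1 - j)%N)^*) ->
  map_poly Num.conj (binform n zeta (1 + 'i *: 'X) (1 - 'i *: 'X)) =
  binform n zeta (1 + 'i *: 'X) (1 - 'i *: 'X).
Proof.
move=> hzeta; rewrite map_poly_binform rmorphB rmorphD rmorph1 /= map_polyZ map_polyX.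
rewrite [X in X *: _](_ : _ = - 'i); last exact: conjCi.
(* Conjugation has exchanged the two arguments; exchanging them on the right too reverses [zeta]
   there, which is the hypothesis on [zeta]. *)
rewrite scaleNr opprK -[RHS]binform_sym /binform; congr (_ + _ + _).
apply: eq_big_nat => j /andP[j1 jn] /=.
rewrite (hzeta (n.+1 - j)%N); first by rewrite subKn // ltnW.
lia.
Qed.

Theorem theorem2p12 (R : realType) (n : nat) (hn : (2 <= n)%N) (hev : ~~ odd n)
    (zeta : nat -> R[i])
    (hzeta : forall j : nat, (1 <= j <= n)%N -> zeta j = (zeta (n.+1 - j)%N)^*) :
  (exists d : 'I_n.+2 -> R,
     qtilde n zeta =
     \sum_(j < n.+2) (d j)%:C%C *: ('X_ord0 ^+ (n.+1 - j) * 'X_ord_max ^+ j))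
  /\
  (forall d : 'I_n.+2 -> R,
     qtilde n zeta =
     \sum_(j < n.+2) (d j)%:C%C *: ('X_ord0 ^+ (n.+1 - j) * 'X_ord_max ^+ j) ->
     d ord0 != 0 ->
     discriminant (dehomog (qtilde n zeta)) =
     2 ^+ (n * n.+1) * \det (Hmx n zeta)).
Proof.
split=> [|d qE d0].
  rewrite qtilde_homog_eval; set Q := binform _ _ _ _.
  have conjQ : map_poly Num.conj Q = Q by exact: conj_binform_Cayley.
  have realQ j : Q`_j \is Num.real.
    by apply/CrealP; rewrite -[in RHS]conjQ coef_map.
  (* The coefficients of [Q] are fixed by conjugation, hence equal to their real parts. *)
  exists (fun j => complex.Re Q`_j).
  by apply: eq_bigr => j _; rewrite RRe_real.
apply: discriminant_dehomog_qtilde; rewrite qE dehomog_binary_form.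
by rewrite fmorph_eq0.
Qed.
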